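(* For every $p$ that is a prime number or zero, the theory $\mathrm{ACFC}_p$ is not model complete.
   Context: A character $\chi:F\to K$ between integral domains is a map with $\chi(ab)=\chi(a)\chi(b)$ for all $a,b\in F$, $\chi(0)=0$ and $\chi(1)=1$. A structure $(F,K;\chi)$ of this kind is a structure in the $2$-sorted language $L$, which consists of two disjoint copies of the language of rings (one for each sort) augmented by a unary function symbol $\chi$ from the first sort to the second. For $n\ge 1$, $\alpha\in F^n$ and $k\in\mathbb{N}^n$ put $\alpha^k=\alpha_1^{k_1}\cdots\alpha_n^{k_n}$. The tuple $\alpha$ is multiplicatively dependent if $\alpha^k=\alpha^l$ for some distinct $k,l\in\mathbb{N}^n$, and multiplicatively independent otherwise. A character $\chi:F\to K$ is generic if it is injective and, for every $n\ge1$ and every multiplicatively independent $\alpha\in F^n$, the tuple $\chi(\alpha)=(\chi(\alpha_1),\dots,\chi(\alpha_n))$ is algebraically independent, in the fraction field of $K$, over its prime field. $\mathrm{ACFC}$ is a recursive set of $\forall\exists$-sentences of $L$ whose models are exactly the structures $(F,K;\chi)$ with $F,K$ algebraically closed fields, $\mathrm{char}(K)=0$ and $\chi$ a generic character. For $p$ prime or zero, $\mathrm{ACFC}_p$ is $\mathrm{ACFC}$ together with sentences expressing $\mathrm{char}(F)=p$. *)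

(* Defs.v *)
(* Mathematical Components, with multinomials for algebraic independence. *)
From HB Require Import structures.
From mathcomp Require Import all_boot all_order all_algebra.
From mathcomp Require Import mpoly.

Set Implicit Arguments.
Unset Strict Implicit.
Unset Printing Implicit Defensive.

Import GRing.Theory.
Local Open Scope ring_scope.

(** * The two-sorted language L *)

Inductive sort : Set := sF | sK.

(* Each sort has its own supply of variables, indexed by nat. *)
Inductive term : sort -> Set :=
| tVar s : nat -> term s
| tZero s : term s
| tOne s : term s
| tAdd s : term s -> term s -> term s
| tOpp s : term s -> term s
| tMul s : term s -> term s -> term s
| tChi : term sF -> term sK.

Inductive formula : Set :=
| fEq s : term s -> term s -> formula
| fBot : formula
| fImp : formula -> formula -> formula
| fAnd : formula -> formula -> formula
| fOr : formula -> formula -> formula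
| fAll : sort -> nat -> formula -> formula
| fEx : sort -> nat -> formula -> formula.

Fixpoint occurs (s : sort) (n : nat) (r : sort) (t : term r) : Prop :=
  match t with
  | tVar r m => r = s /\ m = n
  | tZero _ => False
  | tOne _ => False
  | tAdd _ t u => occurs s n t \/ occurs s n u
  | tOpp _ t => occurs s n t
  | tMul _ t u => occurs s n t \/ occurs s n u
  | tChi t => occurs s n t
  end.

Fixpoint free_in (s : sort) (n : nat) (phi : formula) : Prop :=
  match phi with
  | fEq _ t u => occurs s n t \/ occurs s n u
  | fBot => False
  | fImp f g => free_in s n f \/ free_in s n g
  | fAnd f g => free_in s n f \/ free_in s n g
  | fOr f g => free_in s n f \/ free_in s n g
  | fAll r m f => free_in s n f /\ ~ (r = s /\ m = n)
  | fEx r m f => free_in s n f /\ ~ (r = s /\ m = n)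
  end.

Definition sentence (phi : formula) : Prop := forall s n, ~ free_in s n phi.

Fixpoint quantifier_free (phi : formula) : Prop :=
  match phi with
  | fEq _ _ _ => True
  | fBot => True
  | fImp f g => quantifier_free f /\ quantifier_free g
  | fAnd f g => quantifier_free f /\ quantifier_free g
  | fOr f g => quantifier_free f /\ quantifier_free g
  | fAll _ _ _ => False
  | fEx _ _ _ => False
  end.

Inductive existential : formula -> Prop :=
| existential_qf phi : quantifier_free phi -> existential phi
| existential_ex s n phi : existential phi -> existential (fEx s n phi).

Inductive forall_exists : formula -> Prop :=
| forall_exists_ex phi : existential phi -> forall_exists phi
| forall_exists_all s n phi :
    forall_exists phi -> forall_exists (fAll s n phi).

Definition theory := formula -> Prop.

(** * Structures, satisfaction, model completeness *)

(* The carriers live in the universe of the carriers of closedFieldType.  With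
   a fresh, possibly larger universe, no theory could have exactly the models
   required by is_ACFC below, since large models would not be closedFieldTypes. *)
Record structure : Type := Structure {
  carrier :> sort -> Type@{GRing.ClosedField.axioms_.u0};
  i_zero : forall s, carrier s;
  i_one : forall s, carrier s;
  i_add : forall s, carrier s -> carrier s -> carrier s;
  i_opp : forall s, carrier s -> carrier s;
  i_mul : forall s, carrier s -> carrier s -> carrier s;
  i_chi : carrier sF -> carrier sK
}.

Definition valuation (M : structure) := forall s, nat -> M s.

Definition update (M : structure) (v : valuation M) (s : sort) (n : nat) :
    M s -> valuation M :=
  match s return M s -> valuation M with
  | sF => fun a r => match r return nat -> M r with
                     | sF => fun m => if m == n then a else v sF m
                     | sK => v sK
                     end
  | sK => fun a r => match r return nat -> M r with
                     | sF => v sF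
                     | sK => fun m => if m == n then a else v sK m
                     end
  end.

Fixpoint eval (M : structure) (v : valuation M) (s : sort) (t : term s) : M s :=
  match t in term s return M s with
  | tVar s n => v s n
  | tZero s => i_zero M s
  | tOne s => i_one M s
  | tAdd _ t u => i_add (eval v t) (eval v u)
  | tOpp _ t => i_opp (eval v t)
  | tMul _ t u => i_mul (eval v t) (eval v u)
  | tChi t => i_chi (eval v t)
  end.

Fixpoint sat (M : structure) (v : valuation M) (phi : formula) : Prop :=
  match phi with
  | fEq _ t u => eval v t = eval v u
  | fBot => False
  | fImp f g => sat v f -> sat v g
  | fAnd f g => sat v f /\ sat v g
  | fOr f g => sat v f \/ sat v g
  | fAll s n f => forall a : M s, sat (update v n a) f
  | fEx s n f => exists a : M s, sat (update v n a) f
  end.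

Definition models (M : structure) (T : theory) : Prop :=
  forall phi, T phi -> forall v : valuation M, sat v phi.

(* L has no relation symbols besides equality, so embeddings are exactly the
   injective homomorphisms. *)
Record embedding (M N : structure) (h : forall s, M s -> N s) : Prop :=
  Embedding {
    emb_inj : forall s, injective (h s);
    emb_zero : forall s, h s (i_zero M s) = i_zero N s;
    emb_one : forall s, h s (i_one M s) = i_one N s;
    emb_add : forall s (a b : M s), h s (i_add a b) = i_add (h s a) (h s b);
    emb_opp : forall s (a : M s), h s (i_opp a) = i_opp (h s a);
    emb_mul : forall s (a b : M s), h s (i_mul a b) = i_mul (h s a) (h s b);
    emb_chi : forall a : M sF, h sK (i_chi a) = i_chi (h sF a)
  }.

Definition elementary (M N : structure) (h : forall s, M s -> N s) : Prop :=
  forall (phi : formula) (v : valuation M),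
    sat v phi <-> sat (fun s n => h s (v s n)) phi.

Definition model_complete (T : theory) : Prop :=
  forall M N : structure, models M T -> models N T ->
  forall h : forall s, M s -> N s, embedding h -> elementary h.

(** * Generic characters *)

Definition character (F K : idomainType) (chi : F -> K) : Prop :=
  [/\ forall a b, chi (a * b) = chi a * chi b, chi 0 = 0 & chi 1 = 1].

Definition monomial (R : idomainType) (n : nat) (alpha : 'I_n -> R)
    (k : {ffun 'I_n -> nat}) : R :=
  \prod_(i < n) alpha i ^+ k i.

Definition mult_dependent (R : idomainType) (n : nat) (alpha : 'I_n -> R) :
    Prop :=
  exists k l : {ffun 'I_n -> nat},
    k <> l /\ monomial alpha k = monomial alpha l.

Definition mult_independent (R : idomainType) (n : nat) (alpha : 'I_n -> R) :
    Prop :=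
  ~ mult_dependent alpha.

(* The prime field is the intersection of all subfields. *)
Definition in_prime_field (E : fieldType) (x : E) : Prop :=
  forall S : {pred E}, GRing.divring_closed S -> x \in S.

Definition alg_independent (E : fieldType) (n : nat) (b : 'I_n -> E) : Prop :=
  forall P : {mpoly E[n]},
    (forall m : 'X_{1..n}, in_prime_field P@_m) -> P.@[b] = 0 -> P = 0.

Definition generic (F K : idomainType) (chi : F -> K) : Prop :=
  [/\ character chi,
      injective chi &
      forall (n : nat) (alpha : 'I_n -> F), (1 <= n)%N ->
        mult_independent alpha ->
        alg_independent (fun i => tofrac (chi (alpha i)) : {fraction K})].

(** * The theories ACFC and ACFC_p *)

Definition ring_of_sort (F K : idomainType) (s : sort) : idomainType :=
  match s with sF => F | sK => K end.

Definition pair_structure (F K : idomainType) (chi : F -> K) : structure :=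
  @Structure (fun s => ring_of_sort F K s)
    (fun s => 0) (fun s => 1) (fun s a b => a + b) (fun s a => - a)
    (fun s a b => a * b) chi.

Definition ACFC_structure (M : structure) : Prop :=
  exists (F K : closedFieldType) (chi : F -> K),
    [/\ M = pair_structure chi, [pchar K] =i pred0 & generic chi].

(* An axiomatization by forall-exists sentences of the class of structures
   above; such a theory is unique up to logical equivalence. *)
Definition is_ACFC (T : theory) : Prop :=
  (forall phi, T phi -> sentence phi /\ forall_exists phi) /\
  (forall M : structure, models M T <-> ACFC_structure M).

Fixpoint numeral (s : sort) (n : nat) : term s :=
  match n with
  | 0 => tZero s
  | m.+1 => tAdd (numeral s m) (tOne s)
  end.

(* Sentences expressing char(F) = p, for p prime or zero. *)
Definition char_axioms (p : nat) : theory := fun phi =>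
  if p == 0%N then
    exists q : nat,
      prime q /\ phi = fImp (fEq (numeral sF q) (tZero sF)) fBot
  else phi = fEq (numeral sF p) (tZero sF).

Definition with_char (T : theory) (p : nat) : theory :=
  fun phi => T phi \/ char_axioms p phi.

(* Main.v *)
Require Import Defs.
From mathcomp Require Import all_boot.
From HB Require Import structures.
From mathcomp Require Import all_order all_algebra all_field.
From mathcomp Require Import mpoly.
From mathcomp Require Import boolp classical_sets functions filter.

(** Model completeness already fails for the definable set chi(F): an element
of K may become a value of the character when only the field F grows.  Take
algebraically closed fields F and F' of characteristic p, an embedding iota of
F in F' that misses some t, and a generic character chi from F' to K.  Then
(F, K; chi o iota) and (F', K; chi) are both models, (iota, id) embeds the first
in the second, and the element chi(t) of K is the image of a point of F' but not
of a point of F, because chi is injective.  So everything rests on the existence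
of a generic character on F'; [generic_character_exists] provides one on every
countable field.

Quotients of distinct monomials in a multiplicatively independent tuple have
infinite order, so algebraic independence of the images follows once any
elements u_1, .., u_r whose pairwise quotients have infinite order have images
that are linearly independent over the prime field.  This is forced by orders
of growth.  The values of chi are sequences of algebraic numbers, taken
modulo an ultrafilter; sequences whose sizes are of pairwise different orders
satisfy no nontrivial linear relation with constant coefficients, because the
largest term dominates ([separated_lincomb_neq0]).  An ultrapower of an
algebraically closed field is again algebraically closed, which yields K.

It remains to find a multiplicative map f from the nonzero elements of F' to
sequences of nonzero algebraic numbers, such that f(u) tends to infinity or to
zero when u has infinite order, and f(u) is nowhere 1 when u <> 1 is torsion
([growing_hom]).  By Zorn's lemma there is a maximal partial such map, and its
domain is everything.  If no power of u lies in the domain, u can be sent to a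
sequence growing faster than the countably many values already used
([dom_power]).  If u^q lies in the domain for a prime q, u can be sent to a
pointwise q-th root of the value at u^q; the growth condition is insensitive to
such roots, and injectivity on torsion survives provided the q-th roots of
unity were treated first ([dom_unity_root], [dom_prime_root]). *)

Set Implicit Arguments.
Unset Strict Implicit.
Unset Printing Implicit Defensive.
Import Order.TTheory GRing.Theory Num.Theory.

(** * Ultrapowers of algebraically closed fields *)

Section Ultrapower.
Local Open Scope ring_scope.
Local Open Scope classical_set_scope.
Local Open Scope quotient_scope.

Variables (C : closedFieldType) (U : set_system nat).
Hypothesis U_ultra : UltraFilter U.

Definition ultranull : {pred nat -> C} := fun f => `[< U [set i | f i = 0] >].

Lemma ultranullP f : reflect (U [set i | f i = 0]) (f \in ultranull).
Proof. exact: asboolP. Qed.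

Lemma ultranull_idealr : idealr_closed ultranull.
Proof.
split.
- by apply/ultranullP; apply: filterS filterT => i.
- by apply/ultranullP => /filter_ex[i /= /eqP]; rewrite oner_eq0.
- move=> g f h /ultranullP f0 /ultranullP h0; apply/ultranullP.
  apply: filterS (filterI f0 h0) => i [/= fi hi].
  by rewrite !fctE fi hi mulr0 addr0.
Qed.

HB.instance Definition _ :=
  isIdealr.Build (nat -> C) ultranull ultranull_idealr.

Definition ultrapower : Type := {ideal_quot ultranull}.
HB.instance Definition _ := GRing.ComNzRing.on ultrapower.

Definition ultraclass (f : nat -> C) : ultrapower := \pi_({ideal_quot ultranull}) f.

Lemma ultraclass_zmod_morphism : zmod_morphism ultraclass.
Proof. by move=> f g; rewrite /ultraclass rmorphB. Qed.

Lemma ultraclass_monoid_morphism : monoid_morphism ultraclass.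
Proof. by split=> [|f g]; rewrite /ultraclass ?rmorph1 ?rmorphM. Qed.

HB.instance Definition _ := GRing.isZmodMorphism.Build
  (nat -> C) ultrapower ultraclass ultraclass_zmod_morphism.
HB.instance Definition _ := GRing.isMonoidMorphism.Build
  (nat -> C) ultrapower ultraclass ultraclass_monoid_morphism.

Lemma ultraclass_eq0 f : (ultraclass f == 0) = (f \in ultranull).
Proof. by rewrite -(rmorph0 ultraclass) /ultraclass -Quotient.idealrBE subr0. Qed.

Lemma ultraclassE x : {f | x = ultraclass f}.
Proof. by exists (repr (x : {ideal_quot ultranull})); rewrite /ultraclass reprK. Qed.

Definition ultrainv (x : ultrapower) : ultrapower :=
  ultraclass (fun i => ((repr (x : {ideal_quot ultranull})) i)^-1).

(** A sequence that is not null is nonzero on a set of the ultrafilter, where its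
pointwise inverse is an inverse. *)
Lemma ultramulV : forall x, x != 0 -> ultrainv x * x = 1.
Proof.
move=> x; rewrite /ultrainv; set f := repr _.
have -> : x = ultraclass f by rewrite /ultraclass /f reprK.
rewrite ultraclass_eq0 => /ultranullP nf.
apply/eqP; rewrite -subr_eq0 -rmorphM -(rmorph1 ultraclass) -rmorphB.
rewrite ultraclass_eq0; apply/ultranullP.
have [//|nf0] := in_ultra_setVsetC [set i | f i = 0] U_ultra.
apply: filterS nf0 => i /= /eqP fi.
by rewrite !fctE mulVf // subrr.
Qed.

Lemma ultrainv0 : ultrainv 0 = 0.
Proof.
apply/eqP; rewrite ultraclass_eq0; apply/ultranullP; set f := repr _.
have /ultranullP : f \in ultranull by rewrite -ultraclass_eq0 /ultraclass /f reprK.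
by apply: filterS => i /= ->; rewrite invr0.
Qed.

HB.instance Definition _ :=
  GRing.ComNzRing_isField.Build ultrapower ultramulV ultrainv0.

(** A root of a monic polynomial over the ultrapower is found by solving,
index by index, the polynomials obtained from representatives of the
coefficients. *)
Lemma ultrapower_closed : GRing.closed_field_axiom ultrapower.
Proof.
move=> n P n_gt0; pose p k := sval (ultraclassE (P k)).
have pE k : P k = ultraclass (p k) := svalP (ultraclassE (P k)).
have /choice[x xE] i : exists x : C, x ^+ n = \sum_(k < n) p k i * x ^+ k.
  exact: (@solve_monicpoly C n (fun k => p k i) n_gt0).
exists (ultraclass x); rewrite -rmorphXn.
rewrite (eq_bigr (fun k : 'I_n => ultraclass (p k * x ^+ k))); last first.
  by move=> k _; rewrite pE rmorphM rmorphXn.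
rewrite -rmorph_sum; congr ultraclass; apply/funext => i.
by rewrite fct_sumE exprfctE xE; apply: eq_bigr => k _; rewrite !fctE.
Qed.

HB.instance Definition _ :=
  Field_isAlgClosed.Build ultrapower ultrapower_closed.

Lemma ultraclass_neq0 f : \oo `<=` U -> (\forall i \near \oo, f i <> 0) ->
  ultraclass f <> 0.
Proof.
move=> ooU f_neq0 /eqP; rewrite ultraclass_eq0 => /ultranullP f0.
by have [i []] := filter_ex (filterI f0 (ooU _ f_neq0)).
Qed.
End Ultrapower.

(** * Orders of growth of sequences of algebraic numbers *)

Section Growth.
Local Open Scope ring_scope.
Local Open Scope classical_set_scope.
Implicit Types v w x y z : nat -> algC.

(** Only natural constants are allowed, which is enough since the absolute
value of an algebraic number is bounded by an integer. *)
Definition dominated v w : Prop :=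
  forall c : nat, \forall i \near \oo, c%:R * `|v i| < `|w i|.

Definition separated v w : Prop := dominated v w \/ dominated w v.

Lemma dominated_trans v w x :
  dominated v w -> dominated w x -> dominated v x.
Proof.
move=> vw wx c; apply: filterS (filterI (vw c) (wx 1%N)) => i [/= vwi wxi].
by apply: lt_trans vwi _; rewrite mul1r in wxi.
Qed.

Lemma dominated0 w : (forall i, w i != 0) -> dominated 0 w.
Proof.
by move=> w0 c; apply: filterS filterT => i _; rewrite /= normr0 mulr0 normr_gt0.
Qed.

Lemma dominatedD v w x : dominated v x -> dominated w x -> dominated (v + w) x.
Proof.
move=> vx wx c; apply: filterS (filterI (vx (2 * c)%N) (wx (2 * c)%N)) => i [/=].
rewrite natrM => vxi wxi; rewrite -(ltr_pM2l (ltr0n algC 2)).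
rewrite [X in _ < X]mulr_natl mulr2n.
apply: le_lt_trans (ltrD vxi wxi); rewrite -mulrDr -[leRHS]mulrA.
have norm_vw := ler_normD (v i) (w i).
exact: ler_wpM2l (ler0n algC 2) _ _ (ler_wpM2l (ler0n algC c) norm_vw).
Qed.

Lemma dominatedZ a v w : dominated v w -> dominated (cst a * v) w.
Proof.
move=> vw c; have := archi_boundP (normr_ge0 a); set N := Num.bound _ => aN.
apply: filterS (vw (c * N)%N) => i; apply: le_lt_trans.
rewrite normrM mulrA ler_wpM2r ?normr_ge0 // natrM ler_wpM2l ?ler0n //.
exact: ltW.
Qed.

Lemma dominated_sum (I : eqType) (s : seq I) (c : I -> algC)
    (w : I -> nat -> algC) x :
  (forall i, x i != 0) -> {in s, forall k, dominated (w k) x} ->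
  dominated (\sum_(k <- s) cst (c k) * w k) x.
Proof.
move=> x0 ws; rewrite big_seq; elim/big_ind: _ => [|v v'|k /ws].
- exact: dominated0.
- exact: dominatedD.
- exact: dominatedZ.
Qed.

Lemma dominatedM v w x : (forall i, x i != 0) ->
  dominated v w -> dominated (v * x) (w * x).
Proof.
move=> x0 vw c; apply: filterS (vw c) => i.
by rewrite !fctE !normrM mulrA ltr_pM2r ?normr_gt0.
Qed.

(** The converse of the obvious compatibility with powers: it is what lets
growth conditions pass to roots. *)
Lemma dominatedX_inv n v w : (0 < n)%N ->
  dominated (v ^+ n) (w ^+ n) -> dominated v w.
Proof.
move=> n0 vw c; apply: filterS (vw (c ^ n)%N) => i.
rewrite !fctE !normrX natrX -exprMn ltr_pXn2r // nnegrE ?normr_ge0 //.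
by rewrite mulr_ge0 ?ler0n ?normr_ge0.
Qed.

Lemma separatedM v w x : (forall i, x i != 0) ->
  separated v w -> separated (v * x) (w * x).
Proof. by move=> x0 [] H; [left|right]; apply: dominatedM. Qed.

Lemma separatedX_inv n v : (0 < n)%N -> separated (v ^+ n) 1 -> separated v 1.
Proof.
by move=> n0; rewrite -{1}[1](expr1n _ n) => -[] /(dominatedX_inv n0);
  [left|right].
Qed.

Lemma separated_neq v w : separated v w -> \forall i \near \oo, v i <> w i.
Proof.
by case=> /(_ 1%N); apply: filterS => i; rewrite mul1r => /[swap] ->;
  rewrite ltxx.
Qed.

Lemma separated_max (I : eqType) (s : seq I) (w : I -> nat -> algC) :
  {in s &, forall k l, k != l -> separated (w k) (w l)} -> s != [::] ->
  exists2 m, m \in s & {in s, forall k, k != m -> dominated (w k) (w m)}.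
Proof.
elim: s => [//|k [|l s] IH] sep _.
  by exists k => [|l]; rewrite ?inE // => /eqP ->; rewrite eqxx.
have [|//|m ms mP] := IH.
  by move=> a b ha hb; apply: sep; rewrite inE ?ha ?hb orbT.
have [km|nkm] := eqVneq k m.
  exists k; first by rewrite mem_head.
  by move=> a; rewrite inE => /orP[/eqP ->|]; [rewrite eqxx|rewrite km; apply: mP].
have m_kls : m \in k :: l :: s by rewrite inE ms orbT.
have [dom|dom] := sep k m (mem_head _ _) m_kls nkm.
- exists m => //.
  by move=> a; rewrite inE => /orP[/eqP -> //|]; apply: mP.
- exists k; first by rewrite mem_head.
  move=> a; rewrite inE => /orP[/eqP ->|as_ _]; first by rewrite eqxx.
  by have [-> //|am] := eqVneq a m; apply: dominated_trans (mP _ _ am) dom.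
Qed.

(** Among sequences of pairwise different orders one dominates all the others,
hence dominates the rest of the combination, which cannot cancel it. *)
Lemma separated_lincomb_neq0 (I : eqType) (s : seq I) (c : I -> algC)
    (w : I -> nat -> algC) :
  uniq s -> s != [::] -> {in s, forall k, c k != 0} ->
  {in s, forall k i, w k i != 0} ->
  {in s &, forall k l, k != l -> separated (w k) (w l)} ->
  \forall i \near \oo, (\sum_(k <- s) cst (c k) * w k) i <> 0.
Proof.
move=> us sn0 c0 w0 sep; have [m ms mP] := separated_max sep sn0.
have /= dom : dominated (\sum_(k <- rem m s) cst (c k) * w k) (w m).
  apply: dominated_sum => [i|k ks]; first exact: w0.
  by move: ks; rewrite mem_rem_uniq // inE => /andP[km ks]; apply: mP.
have := archi_boundP (normr_ge0 (c m)^-1); set N := Num.bound _ => cN.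
(* A vanishing combination would give N * |c_m| * |w_m i| < |w_m i|, whereas
   N was chosen larger than 1 / |c_m|. *)
apply: filterS (dom N) => i; rewrite (big_rem m ms) /= => lt_rest.
rewrite fctE => /eqP; rewrite addrC addr_eq0 => /eqP rest.
move: lt_rest; rewrite rest normrN !fctE normrM mulrA.
rewrite gtr_pMl; last by rewrite normr_gt0 w0.
rewrite -ltr_pdivlMr; last by rewrite normr_gt0 c0.
by rewrite div1r => /(lt_trans cN); rewrite normfV ltxx.
Qed.

(** A diagonal argument: the value at i takes care of the sequences of index at
most i.  The lower bound by 1 makes the powers of the new sequence dominate as
well. *)
Lemma countable_dominated (v : nat -> nat -> algC) :
  exists2 y : nat -> algC, (forall i, 1 <= `|y i|) & forall k, dominated (v k) y.
Proof.
pose y i : algC := 1 + \sum_(k < i.+1) i%:R * `|v k i|.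
have sum_ge0 i : 0 <= \sum_(k < i.+1) i%:R * `|v k i|.
  by apply: sumr_ge0 => k _; rewrite mulr_ge0 ?ler0n.
have normy i : `|y i| = y i by rewrite ger0_norm // addr_ge0.
exists y => [i|k c]; first by rewrite normy lerDl.
exists (maxn k c) => // i /=; rewrite geq_max => /andP[ki ci].
rewrite normy; apply: le_lt_trans (_ : i%:R * `|v k i| < _).
  by rewrite ler_wpM2r ?normr_ge0 // ler_nat.
rewrite /y (bigD1 (Ordinal (ki : (k < i.+1)%N))) //= addrCA ltrDl.
by rewrite ltr_wpDr // sumr_ge0 // => j _; rewrite mulr_ge0 ?ler0n.
Qed.
End Growth.

(** * Extending partial multiplicative maps *)

Section Torsion.
Local Open Scope ring_scope.
Variable F : fieldType.
Implicit Types u v : F.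

Definition torsion u : Prop := exists2 n, (0 < n)%N & u ^+ n = 1.

Lemma torsionV u : torsion u -> torsion u^-1.
Proof. by case=> n n0 un; exists n => //; rewrite exprVn un invr1. Qed.

Lemma torsionX u n : torsion u -> torsion (u ^+ n).
Proof. by case=> m m0 um; exists m => //; rewrite exprAC um expr1n. Qed.

Lemma torsionX_inv u n : (0 < n)%N -> torsion (u ^+ n) -> torsion u.
Proof. by move=> n0 [m m0 um]; exists (n * m)%N; rewrite ?muln_gt0 ?n0 // exprM. Qed.

End Torsion.

Section Extension.
Local Open Scope ring_scope.
Local Open Scope classical_set_scope.
Variable F : fieldType.
Implicit Types (p r s t : F * (nat -> algC)) (S : set (F * (nat -> algC))).

Definition nonvanishing p := p.1 != 0 /\ forall i, p.2 i != 0.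

(** Conditions on a point (u, f(u)) of the graph of a multiplicative map f.
The second one, imposed on a subgroup of pairs, says that this subgroup is the
graph of a function; the last two make the map injective on torsion at every
index, and of nontrivial growth elsewhere.  All of them concern single points,
so that they pass to unions of chains. *)
Record admissible p : Prop := Admissible {
  admissible_nonvanishing : nonvanishing p;
  admissible_functional : p.1 = 1 -> p.2 = 1;
  admissible_torsion : forall i, torsion p.1 -> p.2 i = 1 -> p.1 = 1;
  admissible_separated : ~ torsion p.1 -> separated p.2 1
}.

Definition pinv p : F * (nat -> algC) := (p.1^-1, fun i => (p.2 i)^-1).

Lemma pinvK p : pinv (pinv p) = p.
Proof. by case: p => u z; congr pair; [|apply/funext => i]; rewrite /= invrK. Qed.

Lemma mulpV p : nonvanishing p -> p * pinv p = 1.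
Proof.
case: p => u z [/= u0 z0]; congr pair; rewrite /= ?divff //.
by apply/funext => i; rewrite !fctE divff.
Qed.

Lemma nonvanishingM p r : nonvanishing p -> nonvanishing r -> nonvanishing (p * r).
Proof. by move=> [p0 p0'] [r0 r0']; split=> [|i]; rewrite /= ?fctE mulf_neq0. Qed.

Lemma nonvanishingV p : nonvanishing p -> nonvanishing (pinv p).
Proof. by move=> [p0 p0']; split=> [|i]; rewrite /= invr_neq0. Qed.

Lemma fst_expr p n : (p ^+ n).1 = p.1 ^+ n.
Proof. by elim: n => // n IH; rewrite !exprS /= IH. Qed.

Lemma snd_expr p n : (p ^+ n).2 = p.2 ^+ n.
Proof. by elim: n => // n IH; rewrite !exprS /= IH. Qed.

Lemma nonvanishingX p n : nonvanishing p -> nonvanishing (p ^+ n).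
Proof.
by case=> p0 p0'; split=> [|i]; rewrite ?fst_expr ?snd_expr ?exprfctE expf_neq0.
Qed.

Lemma separatedV (z : nat -> algC) : (forall i, z i != 0) ->
  separated z 1 -> separated (fun i => (z i)^-1) 1.
Proof.
move=> z0 /(@separatedM _ _ (fun i => (z i)^-1)) [i||]; first by rewrite invr_neq0.
  by rewrite mul1r; have -> : z * (fun i => (z i)^-1) = 1; [apply/funext => i;
    rewrite fctE divff | right].
by rewrite mul1r; have -> : z * (fun i => (z i)^-1) = 1; [apply/funext => i;
  rewrite fctE divff | left].
Qed.

Lemma admissibleV p : admissible p -> admissible (pinv p).
Proof.
move=> [p0 fct tor sep]; split; first exact: nonvanishingV.
- move=> /= /(congr1 GRing.inv); rewrite invrK invr1 => /fct ->.
  by apply/funext => i; rewrite invr1.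
- move=> i /= /torsionV; rewrite invrK => tp /(congr1 GRing.inv).
  by rewrite invrK invr1 => /(tor _ tp) ->; rewrite invr1.
- move=> /= ntp; apply: separatedV p0.2 _; apply: sep => /torsionV.
  exact: ntp.
Qed.

(** Partial multiplicative maps, encoded as subgroups of the product group;
the empty set qualifies, being the union of the empty chain. *)
Definition partial_hom S : Prop :=
  S `<=` admissible /\ forall p r, S p -> S r -> S (p * pinv r).

Section PartialHomTheory.
Variable S : set (F * (nat -> algC)).
Hypotheses (S_hom : partial_hom S) (S_neq0 : S !=set0).

Lemma hom_admissible p : S p -> admissible p. Proof. exact: S_hom.1. Qed.

Lemma hom1 : S 1.
Proof.
have [p Sp] := S_neq0; rewrite -(@mulpV p); first exact: S_hom.2.
exact: admissible_nonvanishing (hom_admissible Sp).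
Qed.

Lemma homV p : S p -> S (pinv p).
Proof. by rewrite -[pinv p]mul1r; apply: S_hom.2 hom1. Qed.

Lemma homM p r : S p -> S r -> S (p * r).
Proof. by rewrite -{2}[r]pinvK => Sp /homV; apply: S_hom.2. Qed.

Lemma homX p n : S p -> S (p ^+ n).
Proof.
move=> Sp; elim: n => [|n IH]; first exact: hom1.
by rewrite exprS; apply: homM.
Qed.

Lemma hom_functional p r : S p -> S r -> p.1 = r.1 -> p.2 = r.2.
Proof.
move=> Sp Sr e; have ar := admissible_nonvanishing (hom_admissible Sr).
have := admissible_functional (hom_admissible (S_hom.2 _ _ Sp Sr)).
rewrite /= e divff ?ar.1 // => /(_ erefl) pr.
apply/funext => i; have pri : p.2 i / r.2 i = 1 := congr1 (@^~ i) pr.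
by rewrite -[LHS](divfK (ar.2 i)) pri mul1r.
Qed.

(** The subgroup generated by S and b consists of the x with x b^m = s b^n for
some s in S; such an x, or its inverse, is s' b^j with s' in S and j a natural
number, so that admissibility is only needed for natural powers of b. *)
Lemma hom_extend b : nonvanishing b ->
  (forall s j, S s -> admissible (s * b ^+ j)) ->
  exists2 S', partial_hom S' & S `<=` S' /\ S' b.
Proof.
move=> b0 adm.
pose S' p := nonvanishing p /\
  exists s m n, S s /\ p * b ^+ m = s * b ^+ n.
exists S'; last split.
- split.
    move=> p [p0 [s [m [n [Ss e]]]]].
    have bX k : nonvanishing (b ^+ k) by exact: nonvanishingX.
    have [le_mn|/ltnW le_nm] := leqP m n.
      have -> : p = s * b ^+ (n - m); last exact: adm.
      rewrite -[p]mulr1 -(mulpV (bX m)) mulrA e -{1}(subnK le_mn) exprD.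
      by rewrite -!mulrA mulpV // mulr1.
    have -> : p = pinv (pinv s * b ^+ (m - n)); last first.
      by apply/admissibleV/adm/homV.
    have s0 := admissible_nonvanishing (hom_admissible Ss).
    have -> : pinv s * b ^+ (m - n) = pinv p; last by rewrite pinvK.
    have e' : p * b ^+ (m - n) = s.
      rewrite -[LHS]mulr1 -(mulpV (bX n)) mulrA -[p * _ * _]mulrA -exprD.
      by rewrite subnK // e -mulrA mulpV // mulr1.
    rewrite -[LHS]mulr1 -(mulpV p0) [p * _]mulrC mulrCA -mulrA.
    by rewrite [_ * p]mulrC e' [pinv s * s]mulrC mulpV // mulr1.
  move=> p r [p0 [s [m [n [Ss e]]]]] [r0 [t [k [l [St e']]]]]; split.
    by apply: nonvanishingM => //; exact: nonvanishingV.
  have t0 := admissible_nonvanishing (hom_admissible St).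
  exists (s * pinv t), (m + l)%N, (n + k)%N; split; first exact: S_hom.2.
  have bl : b ^+ l = pinv t * r * b ^+ k.
    by rewrite -mulrA e' mulrA [_ * t]mulrC mulpV // mul1r.
  rewrite !exprD bl.
  transitivity (p * b ^+ m * pinv t * b ^+ k * (r * pinv r)); last first.
    by rewrite mulpV // mulr1 e !mulrA; congr (_ * _); rewrite mulrAC.
  by rewrite -!mulrA; congr (_ * _); rewrite mulrCA; congr (_ * _);
    rewrite mulrC -!mulrA; congr (_ * _); rewrite mulrCA.
- move=> s Ss; split; first exact: admissible_nonvanishing (hom_admissible Ss).
  by exists s, 0%N, 0%N.
- by split=> //; exists 1, 0%N, 1%N; split; [exact: hom1|rewrite mul1r mulr1].
Qed.

End PartialHomTheory.
End Extension.

(** * Maximal partial maps are total *)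

Section Maximal.
Local Open Scope ring_scope.
Local Open Scope classical_set_scope.

Lemma prim_root_of_prime (R : idomainType) (u : R) q :
  prime q -> u != 1 -> u ^+ q = 1 -> q.-primitive_root u.
Proof.
move=> q_pr u1 uq; have [m um mq] := prim_order_exists (prime_gt0 q_pr) uq.
case/primeP: q_pr => _ /(_ m mq) /orP[/eqP m1|/eqP <- //].
by move: u1; rewrite -[u]expr1 -m1 (prim_expr_order um) eqxx.
Qed.

Lemma expf_neq0_inv (R : idomainType) (x : R) q :
  (0 < q)%N -> x ^+ q != 0 -> x != 0.
Proof. by move=> q0; rewrite expf_eq0 q0. Qed.

Variable F : fieldType.
Implicit Types (p r s t : F * (nat -> algC)) (S : set (F * (nat -> algC))).

Definition dom S : set F := fst @` S.

Variable S : set (F * (nat -> algC)).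
Hypotheses (S_hom : partial_hom S) (S_neq0 : S !=set0).
Hypothesis S_max : forall S', partial_hom S' -> S `<=` S' -> S' = S.

Let hom_adm := hom_admissible S_hom.
Let hom_M := homM S_hom S_neq0.
Let hom_V := homV S_hom S_neq0.
Let hom_X := homX S_hom S_neq0.
Let hom_1 := hom1 S_hom S_neq0.

Lemma domM u v : dom S u -> dom S v -> dom S (u * v).
Proof. by move=> [p Sp <-] [r Sr <-]; exists (p * r) => //; apply: hom_M. Qed.

Lemma domV u : dom S u -> dom S u^-1.
Proof. by move=> [p Sp <-]; exists (pinv p) => //; apply: hom_V. Qed.

Lemma domX u n : dom S u -> dom S (u ^+ n).
Proof. by move=> [p Sp <-]; exists (p ^+ n); [apply: hom_X|rewrite fst_expr]. Qed.

Lemma dom_extend b : nonvanishing b ->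
  (forall s j, S s -> admissible (s * b ^+ j)) -> dom S b.1.
Proof.
move=> b0 adm; have [S' S'hom [SS' S'b]] := hom_extend S_hom S_neq0 b0 adm.
by exists b => //; rewrite -(S_max S'hom SS').
Qed.

(** Points with a power in S inherit admissibility from that power, except
where the power loses information, namely at the roots of unity. *)
Lemma admissible_root p q : (0 < q)%N -> nonvanishing p -> S (p ^+ q) ->
  (p.1 ^+ q = 1 -> admissible p) -> admissible p.
Proof.
move=> q0 p0 Spq adm_tor.
have [_ fct tor sep] := hom_adm Spq; move: fct tor sep.
rewrite fst_expr snd_expr => fct tor sep; split=> //.
- by move=> p1; apply: (admissible_functional (adm_tor _)); rewrite ?p1 ?expr1n.
- move=> i tp pi; apply: (admissible_torsion (adm_tor _) tp pi).
  by apply: (tor i); [exact: torsionX|rewrite exprfctE pi expr1n].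
- move=> ntp; apply: (separatedX_inv q0); apply: sep => /(torsionX_inv q0).
  exact: ntp.
Qed.

(** A q-th root of unity u outside the domain could be sent to a constant
primitive q-th root of unity.  As u generates all q-th roots of unity, the
domain contains no nontrivial one, so the new values stay injective on torsion. *)
Lemma dom_unity_root q u : prime q -> u ^+ q = 1 -> dom S u.
Proof.
move=> q_pr uq; have q0 := prime_gt0 q_pr.
have [->|u1] := eqVneq u 1; first by exists 1.
have u_prim := prim_root_of_prime q_pr u1 uq.
apply: contrapT => u_ndom; have [w w_prim] := C_prim_root_exists q0.
have wq := prim_expr_order w_prim.
pose b : F * (nat -> algC) := (u, cst w).
have b0 : nonvanishing b.
  split=> [|i]; apply: (expf_neq0_inv q0); rewrite /=.
    by rewrite uq oner_eq0.
  by rewrite wq oner_eq0.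
have bq : b ^+ q = 1.
  rewrite [LHS]surjective_pairing fst_expr snd_expr /= uq; congr pair.
  by apply/funext => i; rewrite exprfctE /= wq.
apply: (u_ndom); apply: (dom_extend b0) => s j Ss.
have s0 := admissible_nonvanishing (hom_adm Ss).
apply: (admissible_root q0).
- by apply: nonvanishingM => //; apply: nonvanishingX.
- by rewrite exprMn exprAC bq expr1n mulr1; apply: hom_X.
rewrite /= fst_expr exprMn exprAC uq expr1n mulr1 => sq.
have s1 : s.1 = 1.
  apply: contrapT => /eqP s1; apply: (u_ndom).
  have [k ->] := prim_rootP (prim_root_of_prime q_pr s1 sq) uq.
  by apply: domX; exists s.
have -> : s = 1.
  by rewrite [s]surjective_pairing s1 (admissible_functional (hom_adm Ss) s1).
rewrite mul1r; split; first exact: nonvanishingX.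
- rewrite fst_expr snd_expr => /eqP; rewrite -(prim_order_dvd u_prim) => qj.
  apply/funext => i; rewrite exprfctE; apply/eqP.
  by rewrite -(prim_order_dvd w_prim).
- move=> i _; rewrite fst_expr snd_expr exprfctE => /eqP.
  by rewrite -(prim_order_dvd w_prim) (prim_order_dvd u_prim) => /eqP.
- by case; exists q => //; rewrite fst_expr exprAC uq expr1n.
Qed.

(** Any pointwise q-th root y of the value at u^q can be chosen as value at u.
Indeed, if u were outside the domain, a point (u', z) of the form s (u, y)^j with
u'^q = 1 would have u' and hence u^j in the domain by [dom_unity_root]; since u^q is
there too, q divides j and (u', z) already belongs to S. *)
Lemma dom_prime_root q u : prime q -> u != 0 -> dom S (u ^+ q) -> dom S u.
Proof.
move=> q_pr u0 [[g z] Sg /= gE]; have q0 := prime_gt0 q_pr.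
apply: contrapT => u_ndom.
have z0 i : z i != 0 by case: (hom_adm Sg) => -[_ /(_ i)].
pose y i := q.-root (z i).
have yq i : y i ^+ q = z i by rewrite rootCK.
pose b : F * (nat -> algC) := (u, y).
have b0 : nonvanishing b.
  by split=> //= i; apply: (expf_neq0_inv q0); rewrite yq.
have bq : S (b ^+ q).
  rewrite [_ ^+ q]surjective_pairing fst_expr snd_expr /= -gE.
  by have -> : y ^+ q = z by apply/funext => i; rewrite exprfctE yq.
apply: (u_ndom); apply: (dom_extend b0) => s j Ss.
have s0 := admissible_nonvanishing (hom_adm Ss).
have p0 : nonvanishing (s * b ^+ j).
  by apply: nonvanishingM => //; apply: nonvanishingX.
apply: (admissible_root q0) => //.
  by rewrite exprMn exprAC; apply: hom_M; apply: hom_X.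
move=> /(dom_unity_root q_pr); rewrite /= fst_expr /= => suj.
have uj : dom S (u ^+ j).
  have := domM (domV (ex_intro2 _ _ s Ss erefl)) suj.
  by rewrite mulrA mulVf ?mul1r // s0.1.
have [qj|nqj] := boolP (q %| j)%N.
  apply: hom_adm; apply: hom_M => //.
  by rewrite -(divnK qj) mulnC exprM; apply: hom_X.
case: u_ndom; have j0 : (0 < j)%N by case: (j) nqj => //; rewrite dvdn0.
have [k l klE _] := egcdnP q j0.
have coq : gcdn j q = 1%N.
  by apply/eqP; rewrite -/(coprime j q) coprime_sym prime_coprime.
have <- : u ^+ (k * j) / u ^+ (l * q) = u.
  by rewrite klE coq exprD mulrAC divff ?mul1r ?expr1 // expf_neq0.
apply: domM; first by rewrite mulnC exprM; apply: domX.
by apply: domV; rewrite mulnC exprM; apply: domX; exists (g, z).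
Qed.

End Maximal.

Section Transcendental.
Local Open Scope ring_scope.
Local Open Scope classical_set_scope.
Variables (F : fieldType) (F_code : F -> nat).
Hypothesis F_code_inj : injective F_code.
Variable S : set (F * (nat -> algC)).
Hypotheses (S_hom : partial_hom S) (S_neq0 : S !=set0).
Hypothesis S_max : forall S', partial_hom S' -> S `<=` S' -> S' = S.

(** Otherwise u is free over the domain, and can be sent to a sequence that
dominates the countably many values taken so far: all points with a nontrivial
power of u then have nontrivial growth. *)
Lemma dom_power u : u != 0 -> exists2 m, (0 < m)%N & dom S (u ^+ m).
Proof.
move=> u0; apply: contrapT => no_power.
have u_free m : (0 < m)%N -> ~ dom S (u ^+ m).
  by move=> m0 um; apply: no_power; exists m.
(* The value at the element coded by k, and an irrelevant one if there is none. *)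
pose v k := xget 0 [set z | exists2 x, F_code x = k & S (x, z)].
have [y y_ge1 vy] := countable_dominated v.
have y_dom s : S s -> dominated s.2 y.
  move=> Ss; have /(_ (F_code s.1)) := vy; rewrite /v.
  case: xgetP => [z _ [x /F_code_inj -> Sz]|/(_ s.2) []]; last first.
    by exists s.1 => //; rewrite -surjective_pairing.
  by have /= -> := hom_functional S_hom Sz Ss erefl.
have b0 : nonvanishing (u, y).
  by split=> //= i; rewrite -normr_gt0 (lt_le_trans _ (y_ge1 i)).
apply: (u_free 1%N) => //; rewrite expr1.
apply: (dom_extend S_hom S_neq0 S_max b0) => s [|j] Ss.
  by rewrite mulr1; apply: hom_admissible Ss.
have s0 := admissible_nonvanishing (hom_admissible S_hom Ss).
have p_ntor : ~ torsion (s * (u, y) ^+ j.+1).1.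
  rewrite /= fst_expr /= => -[n n0]; rewrite exprMn -exprM => e.
  apply: (u_free (j.+1 * n)%N); first by rewrite muln_gt0.
  have -> : u ^+ (j.+1 * n) = (s.1 ^+ n)^-1.
    by apply: (mulfI (expf_neq0 n s0.1)); rewrite e divff // expf_neq0 // s0.1.
  by apply: (domV S_hom S_neq0); apply: (domX S_hom S_neq0); exists s.
split=> //.
- by apply: nonvanishingM => //; apply: nonvanishingX.
- by move=> e; case: p_ntor; exists 1%N; rewrite // e.
- move=> _; right=> c.
  apply: filterS (y_dom _ (homV S_hom S_neq0 Ss) c) => i /=.
  rewrite snd_expr /= !fctE normr1 mulr1 normrM normrX.
  rewrite normfV ltr_pdivrMr ?normr_gt0 ?s0.2 // => lt_c.
  apply: lt_le_trans lt_c _; rewrite mulrC ler_wpM2l //.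
  by rewrite exprS ler_peMr ?exprn_ege1.
Qed.

(** Let m be the least positive exponent with u^m in the domain.  If m > 1 had a
prime factor q, then u^(m/q) would be in the domain by [dom_prime_root]. *)
Lemma dom_full u : u != 0 -> dom S u.
Proof.
move=> u0; pose P m := (0 < m)%N && `[< dom S (u ^+ m) >].
have exP : exists m, P m.
  by have [m m0 um] := dom_power u0; exists m; rewrite /P m0; apply/asboolP.
case: (ex_minnP exP) => m /andP[m0 /asboolP um] m_min.
have [m1|m1] := leqP m 1%N.
  by move: um; have -> : m = 1%N by apply/eqP; rewrite eqn_leq m1.
have q_pr := pdiv_prime m1; have qm := pdiv_dvd m.
have mq0 : (0 < m %/ pdiv m)%N by rewrite divn_gt0 ?pdiv_gt0 // dvdn_leq.
have : dom S (u ^+ (m %/ pdiv m)).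
  apply: (dom_prime_root S_hom S_neq0 S_max q_pr); first exact: expf_neq0.
  by rewrite -exprM divnK.
move=> /asboolP umq; have := m_min (m %/ pdiv m)%N; rewrite /P mq0 umq.
by move=> /(_ isT); rewrite leqNgt ltn_Pdiv ?prime_gt1.
Qed.

End Transcendental.

Section MainHom.
Local Open Scope ring_scope.
Local Open Scope classical_set_scope.

Lemma maximal_partial_hom (F : fieldType) :
  exists S : set (F * (nat -> algC)), [/\ partial_hom S, S !=set0 &
    forall S', partial_hom S' -> S `<=` S' -> S' = S].
Proof.
pose P S := @partial_hom F S.
have chainP (H : set (set (F * (nat -> algC)))) : H `<=` P ->
    total_on H subset -> P (\bigcup_(X in H) X).
  move=> HP tot; split=> [p [X HX]|p r [X HX Xp] [Y HY Yr]].
    exact: (HP X HX).1.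
  have [XY|YX] := tot X Y HX HY.
    by exists Y => //; apply: (HP Y HY).2 => //; apply: XY.
  by exists X => //; apply: (HP X HX).2 => //; apply: YX.
have [S [S_hom S_max]] := Zorn_bigcup chainP.
have max S' : partial_hom S' -> S `<=` S' -> S' = S.
  move=> S'_hom SS'; apply: contrapT => S'S; apply: (S_max S') => //.
  by rewrite properEneq; split => //; apply/eqP => /esym.
exists S; split=> //; apply/set0P/eqP => S0.
have : [set (1 : F * (nat -> algC))] = S.
  apply: max; last by rewrite S0.
  split=> [p ->|p r -> ->].
    split=> //=.
    - by split=> [|i]; rewrite /= oner_neq0.
    - by case; exists 1%N.
  rewrite mul1r; congr pair; rewrite /= ?invr1 //.
  by apply/funext => i; rewrite invr1.
by rewrite S0 => /(congr1 (fun A => A 1)) /= <-.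
Qed.

Lemma growing_hom (F : fieldType) (code : F -> nat) : injective code ->
  exists f : F -> nat -> algC,
  [/\ f 0 = 0, f 1 = 1, forall u v, f (u * v) = f u * f v &
      forall u, u != 0 -> admissible (u, f u)].
Proof.
move=> code_inj; have [S [S_hom S_neq0 S_max]] := maximal_partial_hom F.
have full := dom_full code_inj S_hom S_neq0 S_max.
have /choice[f fS] u : exists z : nat -> algC,
    if u == 0 then z = 0 else S (u, z).
  have [_|u0] := eqVneq u 0; first by exists 0.
  by have [[x z] Sx <-] := full u u0; exists z.
have f0 : f 0 = 0 by have := fS 0; rewrite eqxx.
have fN u : u != 0 -> S (u, f u) by have := fS u; case: (u == 0).
exists f; split=> // [|u v|u u0].
- exact: (hom_functional S_hom (fN 1 (oner_neq0 F)) (hom1 S_hom S_neq0)).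
- have [->|u0] := eqVneq u 0; first by rewrite mul0r f0 mul0r.
  have [->|v0] := eqVneq v 0; first by rewrite mulr0 f0 mulr0.
  have Suv := homM S_hom S_neq0 (fN u u0) (fN v v0).
  exact: (hom_functional S_hom (fN _ (mulf_neq0 u0 v0)) Suv).
- exact: (hom_admissible S_hom (fN u u0)).
Qed.
End MainHom.

(** * Generic characters with values in an ultrapower *)

Section GenericCharacter.
Local Open Scope ring_scope.
Local Open Scope classical_set_scope.

Lemma monomialX (R : idomainType) n (alpha : 'I_n -> R) (k : {ffun 'I_n -> nat}) d :
  monomial alpha k ^+ d = monomial alpha [ffun i => (d * k i)%N].
Proof.
by rewrite /monomial -prodrXl; apply: eq_bigr => i _; rewrite ffunE mulnC exprM.
Qed.

(** Quotients of distinct monomials in a multiplicatively independent tuple have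
infinite order. *)
Lemma mult_independentX_inj (R : idomainType) n (alpha : 'I_n -> R)
    (k l : {ffun 'I_n -> nat}) d :
  mult_independent alpha -> (0 < d)%N ->
  monomial alpha k ^+ d = monomial alpha l ^+ d -> k = l.
Proof.
move=> ind d0; rewrite !monomialX => kl; apply: contrapT => nkl; apply: ind.
exists [ffun i => (d * k i)%N], [ffun i => (d * l i)%N]; split=> // e.
apply: nkl; apply/ffunP => i; have := congr1 (fun g : {ffun _ -> _} => g i) e.
by rewrite !ffunE => /eqP; rewrite eqn_pmul2l // => /eqP.
Qed.

Lemma mult_independent_neq0 (R : idomainType) n (alpha : 'I_n -> R) i :
  mult_independent alpha -> alpha i != 0.
Proof.
move=> ind; apply/eqP => ai; apply: ind.
pose e m := [ffun j : 'I_n => if j == i then m.+1 else 0%N].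
have e0 m : monomial alpha (e m) = 0.
  by rewrite /monomial (bigD1 i) //= ffunE eqxx ai exprS mul0r mul0r.
exists (e 0%N), (e 1%N); split; last by rewrite !e0.
by move=> /(congr1 (fun g : {ffun _ -> _} => g i)); rewrite !ffunE eqxx.
Qed.

(** The image of a field morphism is a subfield, hence contains the prime field. *)
Lemma in_prime_field_rmorph (k E : fieldType) (iota : {rmorphism k -> E}) (x : E) :
  in_prime_field x -> exists c, x = iota c.
Proof.
move=> px; pose S : {pred E} := fun y => `[< exists c, y = iota c >].
suff /asboolP : x \in S by [].
apply: px; split; first by apply/asboolP; exists 1; rewrite rmorph1.
- by move=> _ _ /asboolP[c ->] /asboolP[d ->]; apply/asboolP; exists (c - d);
    rewrite rmorphB.
- by move=> _ _ /asboolP[c ->] /asboolP[d ->]; apply/asboolP; exists (c / d);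
    rewrite fmorph_div.
Qed.

Variables (F : fieldType) (f : F -> nat -> algC).
Hypotheses (f0 : f 0 = 0) (f1 : f 1 = 1) (fM : forall u v, f (u * v) = f u * f v).
Hypothesis f_adm : forall u, u != 0 -> admissible (u, f u).

Variable U : set_system nat.
Hypotheses (U_ultra : UltraFilter U) (U_oo : \oo `<=` U).

Let K := ultrapower algC U_ultra.

Definition ultrachar (u : F) : K := ultraclass U_ultra (f u).

Lemma f_neq0 u i : u != 0 -> f u i != 0.
Proof. by move=> /f_adm[[_ /(_ i)]]. Qed.

Lemma f_separated u v : u != 0 -> v != 0 -> ~ torsion (u / v) ->
  separated (f u) (f v).
Proof.
move=> u0 v0 ntor; have uv0 : u / v != 0 by rewrite mulf_neq0 ?invr_neq0.
have [_ _ _ /(_ ntor) /=] := f_adm uv0.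
move=> /(@separatedM _ _ (f v)) []; first by move=> i; apply: f_neq0.
  by rewrite mul1r -fM divfK //; left.
by rewrite mul1r -fM divfK //; right.
Qed.

(** For nonzero u and v, the quotient f(u) / f(v) is nowhere 1 if u / v is
torsion, and has nontrivial growth otherwise. *)
Lemma f_eventually_neq u v : u != v -> \forall i \near \oo, f u i <> f v i.
Proof.
move=> uv; have nz i w : w != 0 -> f w i <> 0 by move/(f_neq0 i)/eqP.
have [u0|u0] := eqVneq u 0.
  rewrite u0 f0; apply: filterS filterT => i _ /esym.
  by apply: nz; rewrite -u0 eq_sym.
have [v0|v0] := eqVneq v 0.
  by rewrite v0 f0; apply: filterS filterT => i _; apply: nz.
have [tor|/(f_separated u0 v0)] := pselect (torsion (u / v)); last first.
  exact: separated_neq.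
have uv0 : u / v != 0 by rewrite mulf_neq0 ?invr_neq0.
apply: filterS filterT => i _ fuv.
have : u / v = 1.
  apply: (admissible_torsion (f_adm uv0) (i := i) tor) => /=.
  apply: (mulIf (f_neq0 i v0)).
  by have := congr1 (@^~ i) (fM (u / v) v); rewrite divfK //= mul1r fctE => <-.
by move/(divr1_eq)/eqP; rewrite (negPf uv).
Qed.

Lemma ultrachar_character : character ultrachar.
Proof.
by split=> [u v||]; rewrite /ultrachar ?fM ?f0 ?f1 ?rmorphM ?rmorph0 ?rmorph1.
Qed.

Lemma ultrachar_inj : injective ultrachar.
Proof.
move=> u v /eqP; rewrite -subr_eq0 -rmorphB => /eqP uv.
apply/eqP; apply: contrapT => /negP nuv; move: uv.
apply: ultraclass_neq0 => //; apply: filterS (f_eventually_neq nuv) => i /=.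
by move=> ne /eqP; rewrite subr_eq0 => /eqP.
Qed.

(** Coefficients in the prime field are classes of constant sequences, so a
polynomial relation between the images of the tuple is a linear relation with
constant coefficients between sequences f(u), with u ranging over the monomials;
these have pairwise different orders of growth. *)
Lemma ultrachar_generic : generic ultrachar.
Proof.
split; [exact: ultrachar_character|exact: ultrachar_inj|].
move=> n alpha n0 ind P coefP P0.
pose E := {fraction K}.
pose iota c : E := tofrac (ultraclass U_ultra (cst c)).
have iota_zmod : zmod_morphism iota.
  by move=> c d; rewrite /iota -rmorphB -rmorphB.
have iota_monoid : monoid_morphism iota.
  by split=> [|c d]; rewrite /iota ?rmorph1 // -rmorphM -rmorphM.
pose iotaM := GRing.isZmodMorphism.Build algC E iota iota_zmod.
pose iotaM' := GRing.isMonoidMorphism.Build algC E iota iota_monoid.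
pose iotaR : {rmorphism algC -> E} := HB.pack iota iotaM iotaM'.
have /choice[c cE] m : exists c, P@_m = iota c.
  exact: (in_prime_field_rmorph iotaR (coefP m)).
apply/eqP; apply: contraT => Pn0.
pose k (m : 'X_{1..n}) : {ffun 'I_n -> nat} := [ffun i => m i].
have k_inj : injective k.
  move=> m m' e; apply/mnmP => i.
  by have := congr1 (fun g : {ffun _ -> _} => g i) e; rewrite !ffunE.
pose w m := f (monomial alpha (k m)).
have mon0 m : monomial alpha (k m) != 0.
  by apply/prodf_neq0 => i _; rewrite expf_neq0 // mult_independent_neq0.
have := separated_lincomb_neq0 (msupp_uniq P) _ (c := c) (w := w).
have -> : msupp P != [::] by rewrite msupp_eq0.
have c0 : {in msupp P, forall m, c m != 0}.
  move=> m; rewrite mcoeff_msupp cE; apply: contraNneq => ->.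
  by rewrite -[iota 0]/(iotaR 0) rmorph0.
have w0 : {in msupp P, forall m i, w m i != 0}.
  by move=> m _ i; apply: f_neq0.
have sep : {in msupp P &, forall m m', m != m' -> separated (w m) (w m')}.
  move=> m m' _ _ mm'; apply: f_separated => // -[d d0].
  rewrite exprMn exprVn => /divr1_eq/(mult_independentX_inj ind d0)/k_inj e.
  by rewrite e eqxx in mm'.
move=> /(_ isT c0 w0 sep) /(ultraclass_neq0 (U_ultra := U_ultra) U_oo) [].
apply/eqP; rewrite -tofrac_eq0 -P0 mevalE !rmorph_sum; apply/eqP.
apply: eq_bigr => m _; rewrite cE !rmorphM /=; congr (_ * _).
rewrite /w /monomial (big_morph f fM f1) !rmorph_prod; apply: eq_bigr => i _.
rewrite ffunE -!rmorphXn; congr (tofrac (ultraclass _ _)).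
elim: (m i) => [|j IH].
  by rewrite expr0 f1.
by rewrite !exprS fM IH.
Qed.
End GenericCharacter.

Section Existence.
Local Open Scope ring_scope.
Local Open Scope classical_set_scope.

(** An ultrafilter refining the eventually-true filter identifies sequences that
agree from some index on, which turns eventual nonvanishing into nonvanishing. *)
Lemma generic_character_exists (F : countFieldType) :
  exists (K : closedFieldType) (chi : F -> K), [pchar K] =i pred0 /\ generic chi.
Proof.
have [f [f0 f1 fM f_adm]] := growing_hom (pcan_inj (@pickleK F)).
have [U [U_ultra U_oo]] := ultraFilterLemma eventually_filter.
exists (ultrapower algC U_ultra), (ultrachar f U_ultra); split; last first.
  exact: ultrachar_generic.
move=> q; apply/negP => /andP[q_pr]; rewrite -(rmorph_nat (ultraclass U_ultra)).
apply/negP/eqP; apply: ultraclass_neq0 => //; apply: filterS filterT => i _.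
rewrite natmulfctE /=; apply/eqP; rewrite pnatr_eq0.
by rewrite -lt0n prime_gt0.
Qed.
End Existence.

(** * Towers of closed fields of given characteristic *)

Section ClosedFields.
Local Open Scope ring_scope.

(** The indeterminate X is not a constant, so it is missed by the embedding of F
in an algebraic closure of F(X). *)
Lemma proper_closed_extension (F : countFieldType) :
  exists (F' : countClosedFieldType) (iota : {rmorphism F -> F'}) (t : F'),
    forall a, iota a <> t.
Proof.
pose E := {fraction {poly F}}.
(* Fractions are counted through a chosen numerator and denominator. *)
pose num_den (x : E) := val (repr x).
pose quo (r : {poly F} * {poly F}) : E := (\pi_E (insubd (ratio0 {poly F}) r))%qT.
have num_denK : cancel num_den quo by move=> x; rewrite /quo valKd reprK.
pose E_countable := CanIsCountable num_denK.
pose E' : countFieldType := HB.pack E E_countable.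
have [F' /= [j _]] := countable_algebraic_closure E'.
pose iota : {rmorphism F -> F'} :=
  (j : {rmorphism {fraction {poly F}} -> F'}) \o @tofrac {poly F} \o polyC.
exists F', iota, (j (tofrac 'X)) => a e.
have /eqP : tofrac a%:P = tofrac 'X := fmorph_inj j e.
rewrite tofrac_eq => /eqP /(congr1 (size : {poly F} -> nat)).
by rewrite size_polyX size_polyC; case: (a == 0).
Qed.

(** The algebraic content of [char_axioms]: in characteristic 0 every prime must
be nonzero. *)
Definition has_char (p : nat) (R : nzRingType) : Prop :=
  if p == 0%N then forall q, prime q -> q%:R != 0 :> R else p%:R = 0 :> R.

Lemma has_char_rmorph p (k E : fieldType) (iota : {rmorphism k -> E}) :
  has_char p k -> has_char p E.
Proof.
rewrite /has_char; case: (p == 0%N) => [kP q /kP|/(congr1 iota)].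
  by rewrite -(rmorph_nat iota) fmorph_eq0.
by rewrite rmorph_nat rmorph0.
Qed.

Lemma prime_field_exists p : prime p \/ p = 0%N ->
  exists k : countFieldType, has_char p k.
Proof.
rewrite /has_char => -[p_pr|->].
  exists 'F_p; rewrite eqn0Ngt prime_gt0 //.
  by rewrite pchar_Fp_0.
exists rat => q q_pr; rewrite pnatr_eq0 -lt0n; exact: prime_gt0.
Qed.

Lemma closed_pair_exists p : prime p \/ p = 0%N ->
  exists (F F' : countClosedFieldType) (iota : {rmorphism F -> F'}) (t : F'),
    [/\ has_char p F, has_char p F' & forall a, iota a <> t].
Proof.
move=> /prime_field_exists[k kp].
have [F /= [j _]] := countable_algebraic_closure k.
have [F' [iota [t tP]]] := proper_closed_extension F.
have Fp := has_char_rmorph j kp.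
by exists F, F', iota, t; split=> //; apply: (has_char_rmorph iota).
Qed.

End ClosedFields.

(** * Models of the theory *)

Section Models.
Local Open Scope ring_scope.

(** An injective morphism preserves multiplicative independence. *)
Lemma generic_comp (F F' K : idomainType) (iota : {rmorphism F -> F'})
    (chi : F' -> K) :
  injective iota -> generic chi -> generic (chi \o iota).
Proof.
move=> iota_inj [[chiM chi0 chi1] chi_inj chi_ind]; split.
- by split=> [a b||] /=; rewrite ?rmorphM ?rmorph0 ?rmorph1.
- exact: inj_comp.
- move=> n alpha n0 ind; apply: (chi_ind n (iota \o alpha)) => // -[k [l [kl e]]].
  apply: ind; exists k, l; split=> //; apply: iota_inj.
  by rewrite /monomial !rmorph_prod; under eq_bigr do rewrite rmorphXn;
    under [RHS]eq_bigr do rewrite rmorphXn.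
Qed.

Lemma eval_numeral (F K : idomainType) (chi : F -> K)
    (v : valuation (pair_structure chi)) n :
  eval v (numeral sF n) = n%:R :> F.
Proof. by elim: n => //= n ->; rewrite mulrSr. Qed.

Lemma models_ACFC_p ACFC p (F K : closedFieldType) (chi : F -> K) :
  is_ACFC ACFC -> [pchar K] =i pred0 -> generic chi -> has_char p F ->
  models (pair_structure chi) (with_char ACFC p).
Proof.
move=> [_ ax] K0 chi_gen Fp phi [phiA|phi_char] v.
  by apply: (ax _).2 phiA v; exists F, K, chi.
move: phi_char Fp; rewrite /char_axioms /has_char.
case: (p == 0%N) => [[q [q_pr ->]] Fp|-> Fp] /=; rewrite eval_numeral //.
by move/eqP; rewrite (negPf (Fp q q_pr)).
Qed.
End Models.

Theorem proposition1p6 (ACFC : theory) (ACFC_ax : is_ACFC ACFC)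
  (p : nat) (p_char : prime p \/ p = 0) :
  ~ model_complete (with_char ACFC p).
Proof.
have [F [F' [iota [t [Fp F'p tP]]]]] := closed_pair_exists p_char.
have [K [chi [K0 chi_gen]]] := generic_character_exists F'.
have iota_inj : injective iota by exact: fmorph_inj.
pose M := pair_structure (F := F) (K := K) (chi \o iota).
pose N := pair_structure (F := F') (K := K) chi.
have MT : models M (with_char ACFC p).
  by apply: models_ACFC_p => //; apply: generic_comp.
have NT : models N (with_char ACFC p) by exact: models_ACFC_p.
pose h s : M s -> N s := match s with sF => iota | sK => id end.
have h_emb : embedding h.
  split=> [[]|[]|[]|[]|[]|[]|a] //= *.
  - exact: rmorph0.
  - exact: rmorph1.
  - exact: rmorphD.
  - exact: rmorphN.
  - exact: rmorphM.
(* The element chi t of the common second sort is a value of the character of N,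
   but not of the character of M. *)
pose phi := fEx sF 0 (fEq (tChi (tVar sF 0)) (tVar sK 0)).
pose v : valuation M :=
  fun s => match s with sF => fun=> 0%R | sK => fun=> chi t end.
move=> complete; have [_ descend] := complete M N MT NT h h_emb phi v.
have [|a /= chi_a] := descend; first by exists t.
apply: (tP a).
by case: chi_gen => _ chi_inj _; apply: chi_inj.
Qed.
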